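(* Let $X = (X_{1},\dots,X_{N})$ be a random vector in $\mathbb{R}^{N}$ with independent components such that, for each $n$, $X_{n}$ almost surely takes values in a fixed interval of length $L_{n}$. Let $$\Psi(\nu) := \frac{1}{2}\sqrt{\sum_{n=1}^{N} L_{n}^{2}\nu_{n}^{2}}$$ and let $d_{\perp,\Psi}$ be the corresponding normal distance. Then, for any (measurable) $A \subseteq \mathbb{R}^{N}$, $$\mathbb{P}[X \in A] \leq \exp\left(-\frac{d_{\perp,\Psi}(\mathbb{E}[X],A)^{2}}{2}\right).$$ In particular, if $X$ (with independent components) takes values in a translate of the unit cube $[0,1]^{N}$, then $$\mathbb{P}[X \in A] \leq \exp\left(-2\, d_{\perp}(\mathbb{E}[X],A)^{2}\right),$$ and if $X$ (with independent components) takes values in a translate of the Hamming cube $\{-1,+1\}^{N}$, then $$\mathbb{P}[X \in A] \leq \exp\left(-\frac{d_{\perp}(\mathbb{E}[X],A)^{2}}{2}\right).$$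
   Context: For $p \in \mathbb{R}^{N}$ and $\nu \in (\mathbb{R}^{N})^{\ast} \cong \mathbb{R}^{N}$ let $\mathbb{H}_{p,\nu} := \{x \in \mathbb{R}^{N} : \nu\cdot x \leq \nu \cdot p\}$, and let $t_{+} := \max\{t,0\}$. For a function $\Psi \colon (\mathbb{R}^{N})^{\ast} \to [0,+\infty]$ that is positively homogeneous of degree one, the $\Psi$-normal distance from $x \in \mathbb{R}^{N}$ to $A \subseteq \mathbb{R}^{N}$ is $$d_{\perp,\Psi}(x,A) := \sup\left\{\frac{(\nu\cdot(x-p))_{+}}{\Psi(\nu)} : p \in \mathbb{R}^{N},\ \nu \in (\mathbb{R}^{N})^{\ast},\ A \subseteq \mathbb{H}_{p,\nu}\right\},$$ with the conventions $0/0 = 0$ and $c/0 = +\infty$ for $c>0$; also $\exp(-\infty)=0$. The symbol $d_{\perp}$ denotes $d_{\perp,\Psi}$ in the special case where $\Psi = \|\cdot\|_{2}$ is the Euclidean norm. *)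

(* Defs.v *)
From HB Require Import structures.
From mathcomp Require Import all_boot all_order all_algebra.
From mathcomp Require Import all_classical all_reals all_analysis.

Set Implicit Arguments.
Unset Strict Implicit.
Unset Printing Implicit Defensive.

Import Order.TTheory GRing.Theory Num.Theory.
Import numFieldNormedType.Exports.

Local Open Scope classical_set_scope.
Local Open Scope ring_scope.

(* R^N with its Borel sigma-algebra; row vectors carry no measurable structure
   in the library. *)
Definition borel_rV (R : realType) (N : nat) :=
  g_sigma_algebraType (@open 'rV[R]_N).

Section NormalDistance.
Context {R : realType} {N : nat}.
Implicit Types (x p nu v : 'rV[R]_N) (A : set 'rV[R]_N).

Definition dotrV nu x : R := \sum_(n < N) nu ord0 n * x ord0 n.

(* The library norm on 'rV[R]_N is the sup norm. *)
Definition euclidean_norm nu : R := Num.sqrt (\sum_(n < N) nu ord0 n ^+ 2).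

Definition halfspace p nu : set 'rV[R]_N := [set x | dotrV nu x <= dotrV nu p].

(* For Psi >= 0, division in \bar R is such that 0 / 0 = 0 * +oo = 0, and
   c / 0 = c * +oo = +oo and c / +oo = 0 for real c > 0. *)
Definition normal_distance (Psi : 'rV[R]_N -> \bar R) x A : \bar R :=
  ereal_sup [set r | exists p nu, A `<=` halfspace p nu /\
    r = ((Num.max (dotrV nu (x - p)) 0)%:E / Psi nu)%E].

Definition euclidean_normal_distance : 'rV[R]_N -> set 'rV[R]_N -> \bar R :=
  normal_distance (fun nu => (euclidean_norm nu)%:E).

Definition side_length_Psi (L : 'I_N -> R) nu : \bar R :=
  (2^-1 * Num.sqrt (\sum_(n < N) L n ^+ 2 * nu ord0 n ^+ 2))%:E.

Definition unit_cube : set 'rV[R]_N := [set x | forall n, 0 <= x ord0 n <= 1].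

Definition hamming_cube : set 'rV[R]_N :=
  [set x | forall n, x ord0 n = -1 \/ x ord0 n = 1].

Definition translate v A : set 'rV[R]_N := [set v + x | x in A].

End NormalDistance.

Section RandomVectors.
Context {d : measure_display} {T : measurableType d} {R : realType}.
Variable P : probability T R.

Definition mutually_independent (I : finType) (Y : I -> T -> R) : Prop :=
  forall (J : {set I}) (B : I -> set R), (forall i, measurable (B i)) ->
  P (\bigcap_(i in [set` J]) (Y i @^-1` B i)) =
  (\prod_(i in J) P (Y i @^-1` B i))%E.

Definition component (N : nat) (X : T -> 'rV[R]_N) (n : 'I_N) (w : T) : R :=
  X w ord0 n.

(* [fine] sends infinite expectations to 0; it only matters for components that
   are not integrable. *)
Definition expectation_rV (N : nat) (X : T -> 'rV[R]_N) : 'rV[R]_N :=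
  \row_(n < N) fine 'E_P[component X n].

End RandomVectors.

(* Main.v *)
(** If [A] lies in the half-space [nu . x <= nu . p] and
    [t := nu . (E[X] - p) > 0], then [X \in A] forces the centered sum
    [D := \sum_n nu_n (E[X_n] - X_n)] to be at least [t].  Independence and
    Hoeffding's lemma bound [E[exp (l D)]] by [exp (l^2 S / 8)] with
    [S := \sum_n L_n^2 nu_n^2], and Chernoff's bound at [l := 4 t / S] gives
    [exp (- 2 t^2 / S)], that is [exp (- (t / Psi nu)^2 / 2)].  Taking the
    supremum over [p] and [nu] concludes. *)
Require Import Defs.
From HB Require Import structures.
From mathcomp Require Import all_boot all_order all_algebra.
From mathcomp Require Import all_classical all_reals all_analysis.
From mathcomp Require Import measurable_realfun.
From mathcomp Require Import ring lra.

Set Implicit Arguments.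
Unset Strict Implicit.
Unset Printing Implicit Defensive.

Import Order.TTheory GRing.Theory Num.Theory.
Import numFieldNormedType.Exports.

Local Open Scope classical_set_scope.
Local Open Scope ring_scope.

(** * Real inequalities behind Hoeffding's lemma *)

(** Two-point case of Hoeffding's lemma: the left side is the moment generating function at [u] of a
    centered Bernoulli variable of mean [p]. *)
Lemma bernoulli_mgf_le_ge0 (R : realType) (p u : R) : 0 <= p <= 1 -> 0 <= u ->
  (1 - p) * expR (- (p * u)) + p * expR ((1 - p) * u) <= expR (u ^+ 2 / 8).
Proof.
move=> /andP[p0 p1] u0.
(* [h] is the logarithm of the ratio of the two sides: [h 0 = h' 0 = 0], and
   [h'' >= 0] because [4 q (1 - q) <= 1] for [q := p * expR x / D x]. *)
pose D (x : R) : R := 1 - p + p * expR x.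
pose h (x : R) := x ^+ 2 / 8 + p * x - ln (D x).
pose h' (x : R) := x / 4 + p - p * expR x / D x.
have D0 (x : R) : 0 <= x -> 0 < D x.
  move=> x0; have := expR_gt0 x; have := expR_ge1Dx x; rewrite /D => ? ?; nra.
have dD (x : R) : is_derive x (1 : R) D (p * expR x).
  by rewrite /D; apply: is_derive_eq; rewrite /GRing.scale /=; ring.
have dh (x : R) : 0 <= x -> is_derive x (1 : R) h (h' x).
  move=> /D0 Dx.
  have dln : is_derive x (1 : R) (@ln R \o D) ((D x)^-1 * (p * expR x)).
    by apply: is_derive1_comp; exact: is_derive1_ln.
  rewrite /h; apply: is_derive_eq.
  rewrite /h' /GRing.scale /=; field.
  by rewrite gt_eqF.
pose h2 (x : R) : R := 4^-1 - p * (1 - p) * expR x / D x ^+ 2.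
have dh' (x : R) : 0 <= x -> is_derive x (1 : R) h' (h2 x).
  move=> /D0 Dx.
  have dV : is_derive x (1 : R) (fun y => (D y)^-1)
      (- (D x) ^- 2 *: (p * expR x)).
    by apply: is_deriveV; rewrite gt_eqF.
  rewrite /h'; apply: is_derive_eq.
  rewrite /h2 /GRing.scale /=; rewrite /D in Dx *; field.
  by rewrite gt_eqF.
have cont (f df : R -> R) :
    (forall x : R, 0 <= x -> is_derive x (1 : R) f (df x)) ->
    forall x : R, 0 <= x -> {within `[0, x], continuous f}.
  move=> fdf x x0; apply: derivable_within_continuous => y.
  by rewrite in_itv/= => /andP[/fdf[]].
(* The mean value theorem for [h] on [[0, u]], then for [h'] on [[0, c]], gives
   [h u = h2 e * c * u], whose sign is that of [h2 e]. *)
have [|c + hE] := @MVT_segment R h h' 0 u u0 _ (cont h h' dh u u0).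
  by move=> x; rewrite in_itv/= => /andP[/ltW/dh].
rewrite in_itv/= => /andP[c0 _].
have [|e + h'E] := @MVT_segment R h' h2 0 c c0 _ (cont h' h2 dh' c c0).
  by move=> x; rewrite in_itv/= => /andP[/ltW/dh'].
rewrite in_itv/= => /andP[e0 _].
have h2e : 0 <= h2 e.
  rewrite subr_ge0 ler_pdivrMr ?exprn_gt0 ?D0//.
  (* This square equals [D e ^+ 2 - 4 * p * (1 - p) * expR e]. *)
  have := sqr_ge0 (1 - p - p * expR e); rewrite /D !expr2; nra.
have D1 : D 0 = 1 by rewrite /D expR0 mulr1 subrK.
have h'0 : h' 0 = 0 by rewrite /h' D1 expR0; field.
have h0 : h 0 = 0 by rewrite /h D1 ln1; field.
have hu : 0 <= h u.
  move: h'E hE; rewrite h'0 h0 !subr0 => -> ->.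
  by rewrite !mulr_ge0.
have -> : (1 - p) * expR (- (p * u)) + p * expR ((1 - p) * u) =
    expR (- (p * u)) * D u.
  have -> : (1 - p) * u = - (p * u) + u by ring.
  by rewrite /D expRD; ring.
rewrite -[D u]lnK ?posrE ?D0// -expRD ler_expR.
by move: hu; rewrite /h; lra.
Qed.

(** Exchanging the two atoms, that is [p] with [1 - p] and [u] with [- u], leaves both sides
    unchanged and reduces negative [u] to the previous case. *)
Lemma bernoulli_mgf_le (R : realType) (p u : R) : 0 <= p <= 1 ->
  (1 - p) * expR (- (p * u)) + p * expR ((1 - p) * u) <= expR (u ^+ 2 / 8).
Proof.
move=> p01; have [u0|u0] := leP 0 u; first exact: bernoulli_mgf_le_ge0.
have q01 : 0 <= 1 - p <= 1 by move: p01; lra.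
have v0 : 0 <= - u by rewrite oppr_ge0 ltW.
have := bernoulli_mgf_le_ge0 q01 v0.
by rewrite sqrrN subKr !mulrN opprK addrC.
Qed.

Lemma expR_le_chord (R : realType) (s a b y : R) : a < b -> a <= y <= b ->
  expR (s * y) <=
  (b - y) / (b - a) * expR (s * a) + (y - a) / (b - a) * expR (s * b).
Proof.
move=> ab /andP[ay yb].
have ba : 0 < b - a by rewrite subr_gt0.
have t01 : 0 <= (b - y) / (b - a) <= 1.
  by rewrite divr_ge0 ?subr_ge0 ?(ltW ab)//= ler_pdivrMr// mul1r lerD2l lerN2.
have /andP[t0 t1] := t01.
have := convex_expR (Itv01 t0 t1) (s * a) (s * b).
rewrite !convRE /=.
have -> : unstable.onem ((b - y) / (b - a)) = (y - a) / (b - a).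
  by rewrite /unstable.onem; field; rewrite gt_eqF.
rewrite (_ : (b - y) / (b - a) * (s * a) + _ = s * y) //.
by field; rewrite gt_eqF.
Qed.

(** * Hoeffding's lemma for an almost surely bounded variable *)

Section Hoeffding.
Context d (T : measurableType d) (R : realType) (P : probability T R).
Implicit Types Y f g : T -> R.

(** Were [Q] to hold nowhere, the exceptional null set would be the whole space, of probability
    1. *)
Lemma ae_nonempty (Q : T -> Prop) : {ae P, forall w, Q w} -> exists w, Q w.
Proof.
move=> [M [mM PM QM]]; apply: contrapT => noQ.
have : P M = 1%E.
  suff -> : M = setT by exact: probability_setT.
  by apply/seteqP; split => // w _; apply: QM => Qw; apply: noQ; exists w.
by rewrite PM => /eqP; rewrite eq_sym onee_eq0.
Qed.

Lemma integral_prob_cst (c : R) : (\int[P]_w c%:E = c%:E)%E.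
Proof.
have := integral_cst P measurableT c%:E.
by rewrite /= probability_setT mule1.
Qed.

Lemma ae_bounded_integrable Y (a b : R) : measurable_fun setT Y ->
  {ae P, forall w, a <= Y w <= b} -> P.-integrable setT (EFin \o Y).
Proof.
move=> mY aYb; apply/integrableP; split; first exact/measurable_EFinP.
apply: (@le_lt_trans _ _ (\int[P]_w (`|a| + `|b|)%:E)%E); last first.
  by rewrite integral_prob_cst ltry.
rewrite ae_ge0_le_integral//.
- by apply: measurableT_comp => //; exact/measurable_EFinP.
- apply: filterS aYb => w /andP[aY Yb] _ /=; rewrite lee_fin ler_norml.
  have := ler_norm b; have := ler_norm (- a); rewrite normrN.
  have := normr_ge0 a; have := normr_ge0 b.
  move=> *; apply/andP; split; lra.
Qed.

(** Almost everywhere [g - f] agrees with its absolute value, whose integral is nonnegative. *)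
Lemma ae_le_integral f g : P.-integrable setT (EFin \o f) ->
  P.-integrable setT (EFin \o g) -> {ae P, forall w, f w <= g w} ->
  (\int[P]_w (f w)%:E <= \int[P]_w (g w)%:E)%E.
Proof.
move=> fi gi fg; rewrite -sube_ge0; last first.
  by apply/orP; left; exact: integrable_fin_num fi.
rewrite -(integralB measurableT gi fi).
rewrite (ae_eq_integral (fun w => `|(g w)%:E - (f w)%:E|%E)) //.
- by apply: integral_ge0.
- by apply: emeasurable_funB; [case/integrableP: gi|case/integrableP: fi].
- by apply: measurableT_comp => //; apply: emeasurable_funB;
    [case/integrableP: gi|case/integrableP: fi].
- apply: filterS fg => w fgw _ /=.
  by rewrite ger0_norm// subr_ge0.
Qed.

Lemma integral_affine Y (c e : R) : P.-integrable setT (EFin \o Y) ->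
  P.-integrable setT (fun w => (c + e * Y w)%:E) /\
  (\int[P]_w (c + e * Y w)%:E = (c + e * fine 'E_P[Y])%:E)%E.
Proof.
move=> Yi.
have ci : P.-integrable setT (EFin \o cst c).
  exact: finite_measure_integrable_cst.
have eYi : P.-integrable setT (fun w => e%:E * (Y w)%:E)%E.
  exact: integrableZl.
split.
  by apply: eq_integrable (integrableD measurableT ci eYi).
under eq_integral do rewrite EFinD EFinM.
rewrite (integralD measurableT ci eYi) integralZl//.
rewrite integral_prob_cst EFinD EFinM fineK unlock//.
exact: integrable_fin_num Yi.
Qed.

Lemma expectation_itv Y (a b : R) : measurable_fun setT Y ->
  {ae P, forall w, a <= Y w <= b} -> a <= fine 'E_P[Y] <= b.
Proof.
move=> mY aYb; have Yi := ae_bounded_integrable mY aYb.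
have cst_int (c : R) : P.-integrable setT (EFin \o cst c).
  exact: finite_measure_integrable_cst.
have EY : (\int[P]_w (Y w)%:E = (fine 'E_P[Y])%:E)%E.
  by rewrite unlock fineK//; exact: integrable_fin_num Yi.
rewrite -!lee_fin -EY -[in X in X && _](integral_prob_cst a).
rewrite -[in X in _ && X](integral_prob_cst b).
apply/andP; split.
- by apply: (ae_le_integral (cst_int a) Yi); apply: filterS aYb => w /andP[].
- by apply: (ae_le_integral Yi (cst_int b)); apply: filterS aYb => w /andP[].
Qed.

(** On [[a, b]] the exponential lies below its chord. The chord is affine in [Y], so its expectation
    depends only on the mean [m]: it is the two-point moment generating function with
    [p = (m - a) / (b - a)] and [u = s * (b - a)]. *)
Lemma hoeffding_lemma Y (a b s : R) : measurable_fun setT Y ->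
  {ae P, forall w, a <= Y w <= b} ->
  (\int[P]_w (expR (s * (Y w - fine 'E_P[Y])))%:E <=
   (expR (s ^+ 2 * (b - a) ^+ 2 / 8))%:E)%E.
Proof.
move=> mY aYb; have Yi := ae_bounded_integrable mY aYb.
have := expectation_itv mY aYb; set m := fine _ => /andP[am mb].
have mexp : measurable_fun setT (fun w => expR (s * (Y w - m))).
  apply: measurableT_comp => //; apply: measurable_funM => //.
  exact: measurable_funB.
(* If [b <= a], then [Y] is almost surely equal to its mean and the integrand is almost surely 1. *)
have [ab|ba] := ltP a b; last first.
  have Ym : {ae P, forall w, expR (s * (Y w - m)) = 1}.
    apply: filterS aYb => w /andP[aY Yb].
    suff -> : Y w - m = 0 by rewrite mulr0 expR0.
    by lra.
  rewrite (ae_eq_integral (cst 1%E)) //; last 2 first.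
  - exact/measurable_EFinP.
  - by apply: filterS Ym => w -> _.
  rewrite integral_prob_cst lee_fin.
  by rewrite -[leLHS]expR0 ler_expR divr_ge0// mulr_ge0// sqr_ge0.
have ba : 0 < b - a by rewrite subr_gt0.
pose A := expR (s * (a - m)); pose B := expR (s * (b - m)).
have [affi affE] := @integral_affine Y ((b * A - a * B) / (b - a))
  ((B - A) / (b - a)) Yi.
have chord : {ae P, forall w, expR (s * (Y w - m)) <=
    (b * A - a * B) / (b - a) + (B - A) / (b - a) * Y w}.
  apply: filterS aYb => w /andP[aY Yb].
  have := @expR_le_chord R s (a - m) (b - m) (Y w - m).
  rewrite !opprB !addrA !subrK ltrD2r !lerD2r aY Yb => /(_ ab isT).
  congr (_ <= _); rewrite /A /B.
  by field; rewrite gt_eqF.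
(* The exponential is monotone in [Y w], so on [[a, b]] it is at most [A] or [B] according to the
   sign of [s], hence at most [A + B]. *)
have expi : P.-integrable setT (EFin \o (fun w => expR (s * (Y w - m)))).
  apply: (@ae_bounded_integrable _ 0 (A + B)) => //.
  apply: filterS aYb => w /andP[aY Yb]; rewrite expR_ge0/=.
  have [s0|s0] := leP 0 s.
    rewrite ler_wpDl ?expR_ge0// ler_expR ler_wpM2l//; lra.
  rewrite ler_wpDr ?expR_ge0// ler_expR ler_wnM2l ?(ltW s0)//; lra.
apply: (le_trans (ae_le_integral expi affi chord)).
rewrite affE lee_fin -/m.
have p01 : 0 <= (m - a) / (b - a) <= 1.
  by rewrite divr_ge0 ?subr_ge0 ?(ltW ab)//= ler_pdivrMr// mul1r lerD2r.
have := bernoulli_mgf_le (s * (b - a)) p01.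
have -> : - ((m - a) / (b - a) * (s * (b - a))) = s * (a - m).
  by field; rewrite gt_eqF.
have -> : (1 - (m - a) / (b - a)) * (s * (b - a)) = s * (b - m).
  by field; rewrite gt_eqF.
rewrite exprMn -/A -/B; congr (_ <= _).
by field; rewrite gt_eqF.
Qed.

End Hoeffding.

(** * Weighted integrals of functions of a random variable *)

Section IntegralComp.
Context d (T : measurableType d) (R : realType).
Variable mu : {measure set T -> \bar R}.
Variable Y : T -> R.
Hypothesis mY : measurable_fun setT Y.
Import HBNNSimple.

Lemma ge0_integralZr_real (V : T -> R) (c : R) :
  measurable_fun setT V -> (forall x, 0 <= V x) -> 0 <= c ->
  (\int[mu]_x (V x * c)%:E = (\int[mu]_x (V x)%:E) * c%:E)%E.
Proof.
move=> mV V0 c0.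
have V0' x : setT x -> (0 <= (V x)%:E)%E by rewrite lee_fin.
have mV' : measurable_fun setT (fun x => (V x)%:E) by exact/measurable_EFinP.
rewrite muleC -(ge0_integralZl_EFin mu measurableT V0' mV' c0).
by apply: eq_integral => x _; rewrite mulrC.
Qed.

Lemma integral_nnsfun_comp_mul (g : {nnsfun R >-> R}) (Z : T -> R) :
  measurable_fun setT Z -> (forall x, 0 <= Z x) ->
  (\int[mu]_x (g (Y x) * Z x)%:E =
   \sum_(k \in range g) k%:E *
     \int[mu]_x (\1_(g @^-1` [set k]) (Y x) * Z x)%:E)%E.
Proof.
move=> mZ Z0.
have mind k : measurable_fun setT (fun x => \1_(g @^-1` [set k]) (Y x) * Z x).
  by apply: measurable_funM => //; apply: measurableT_comp.
have mkind k : measurable_fun setT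
    (fun x => (k * (\1_(g @^-1` [set k]) (Y x) * Z x))%:E).
  by apply/measurable_EFinP; apply: measurable_funM.
under eq_integral => x _.
  rewrite fimfunE mulrC mulr_fsumr -fsumEFin//.
  under eq_fsbigr do rewrite mulrCA (mulrC (Z x)).
  over.
rewrite ge0_integral_fsum//; last first.
(* A negative [k] is not a value of the nonnegative [g]: its level set is empty and its term
   vanishes. *)
- move=> k x _; have [k0|k0] := leP 0 k.
    by rewrite lee_fin !mulr_ge0.
  by rewrite preimage_nnfun0// indic0 /= mul0r mulr0.
apply: eq_fsbigr => k _; have [k0|k0] := leP 0 k.
  under eq_integral do rewrite EFinM.
  rewrite ge0_integralZl_EFin//.
  - by move=> x _; rewrite lee_fin mulr_ge0.
  - exact/measurable_EFinP.
rewrite preimage_nnfun0//.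
under eq_integral do rewrite indic0 mul0r mulr0.
under [in RHS]eq_integral do rewrite indic0 mul0r.
by rewrite integral0 mule0.
Qed.

(** The hypothesis says that the measures of densities [Z] and [W] have the same image under [Y].
    Equality passes from indicators to simple functions by linearity, then to [f] by monotone
    convergence. *)
Lemma eq_integral_comp_mul (Z W : T -> R) (f : R -> R) :
  measurable_fun setT Z -> (forall x, 0 <= Z x) ->
  measurable_fun setT W -> (forall x, 0 <= W x) ->
  (forall B, measurable B -> \int[mu]_x (\1_B (Y x) * Z x)%:E =
                             \int[mu]_x (\1_B (Y x) * W x)%:E)%E ->
  measurable_fun setT f -> (forall y, 0 <= f y) ->
  (\int[mu]_x (f (Y x) * Z x)%:E = \int[mu]_x (f (Y x) * W x)%:E)%E.
Proof.
move=> mZ Z0 mW W0 ZW mf f0.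
have mEf : measurable_fun setT (EFin \o f) by exact/measurable_EFinP.
pose g := nnsfun_approx measurableT mEf.
have approx (V : T -> R) : measurable_fun setT V -> (forall x, 0 <= V x) ->
    (\int[mu]_x (f (Y x) * V x)%:E =
     limn (fun n => \int[mu]_x (g n (Y x) * V x)%:E))%E.
  move=> mV V0; rewrite -monotone_convergence//.
  - apply: eq_integral => x _; apply/esym/cvg_lim => //=.
    rewrite EFinM; under eq_fun do rewrite EFinM.
    apply: cvgeZr => //.
    exact: (cvg_nnsfun_approx measurableT mEf (fun y _ => f0 y) (x := Y x)).
  - move=> n; apply/measurable_EFinP; apply: measurable_funM => //.
    by apply: measurableT_comp.
  - by move=> n x _; rewrite lee_fin mulr_ge0.
  - move=> x _ m n mn; rewrite lee_fin ler_wpM2r//.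
    by have /lefP := nd_nnsfun_approx measurableT mEf mn; apply.
rewrite !approx//; congr (limn _); apply/funext => n.
rewrite !integral_nnsfun_comp_mul//; apply: eq_fsbigr => k _.
by rewrite ZW.
Qed.

End IntegralComp.

(** * Expectation of a product of independent factors *)

Section IndependentProducts.
Context d (T : measurableType d) (R : realType) (P : probability T R).
Context (I : finType) (Y : I -> T -> R).
Hypothesis mY : forall i, measurable_fun setT (Y i).
Hypothesis indepY : mutually_independent P Y.

(** A product of indicators is the indicator of the intersection, so this is independence for the
    full index set. *)
Lemma integral_prod_indic (B : I -> set R) :
  (forall i, measurable (B i)) ->
  (\int[P]_w (\prod_i \1_(B i) (Y i w))%:E =
   \prod_i \int[P]_w (\1_(B i) (Y i w))%:E)%E.
Proof.
move=> mB.
have mpre i : measurable (Y i @^-1` B i).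
  by rewrite -[X in measurable X]setTI; exact: mY.
under [RHS]eq_bigr => i _.
  under eq_integral do rewrite -[\1_(B i) (Y i _)]/(\1_(Y i @^-1` B i) _).
  rewrite integral_indic// setIT; over.
have := indepY [set: I]%SET mB.
under [in X in _ = X -> _]eq_bigl do rewrite finset.in_setT.
move=> <-.
have mcap : measurable (\bigcap_(i in [set` [set: I]%SET]) Y i @^-1` B i).
  by apply: fin_bigcap_measurable.
rewrite -[in RHS](setIT (\bigcap_(i in _) _)) -integral_indic//.
apply: eq_integral => w _; congr EFin; rewrite indicE.
have [wB|] := boolP (w \in _).
  rewrite big1// => i _; rewrite indicE mem_set//.
  by move: wB; rewrite inE; apply => /=; rewrite finset.in_setT.
rewrite notin_setE => /existsNP[i /not_implyP[_ wNB]].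
by rewrite (bigD1 i)//= indicE memNset// mul0r.
Qed.

Lemma integral_prod_independent (f : I -> R -> R) :
  (forall i, measurable_fun setT (f i)) -> (forall i y, 0 <= f i y) ->
  (forall i, \int[P]_w (f i (Y i w))%:E \is a fin_num)%E ->
  (\int[P]_w (\prod_i f i (Y i w))%:E = \prod_i \int[P]_w (f i (Y i w))%:E)%E.
Proof.
(* Generalized for the induction: [s] lists the indices at which [g] may fail to be an indicator. *)
suff main (s : seq I) (g : I -> R -> R) :
    (forall i, measurable_fun setT (g i)) -> (forall i y, 0 <= g i y) ->
    (forall i, \int[P]_w (g i (Y i w))%:E \is a fin_num)%E ->
    (forall i, i \notin s -> exists2 B, measurable B & g i = \1_B) ->
    (\int[P]_w (\prod_i g i (Y i w))%:E = \prod_i \int[P]_w (g i (Y i w))%:E)%E.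
  move=> mf f0 ffin; apply: (main (enum I)) => // i.
  by rewrite mem_enum.
(* Induction on the number of factors that are not indicators: by
   [eq_integral_comp_mul] it suffices to replace one of them by indicators. *)
elim: s g => [|k s IH] g mg g0 gfin gind.
  have /choice[B BP] : forall i, exists B, measurable B /\ g i = \1_B.
    by move=> i; have [//|B mB gB] := gind i; exists B.
  transitivity (\int[P]_w (\prod_i \1_(B i) (Y i w))%:E)%E.
    by under eq_integral do under eq_bigr => i _ do rewrite (BP i).2.
  rewrite integral_prod_indic; last by move=> i; have [] := BP i.
  by apply: eq_bigr => i _; under [RHS]eq_integral do rewrite (BP i).2.
(* Finiteness turns the integrals into reals, so that the product of those with [i != k] can serve
   as a constant weight. *)
pose e i := fine (\int[P]_w (g i (Y i w))%:E)%E.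
have eE i : (\int[P]_w (g i (Y i w))%:E = (e i)%:E)%E by rewrite fineK.
have e0 i : 0 <= e i.
  by apply: fine_ge0; apply: integral_ge0 => w _; rewrite lee_fin.
under eq_integral do rewrite (bigD1 k)//=.
rewrite (bigD1 k)//=.
rewrite [X in (_ * X)%E](_ : _ = (\prod_(i | i != k) e i)%:E)%E; last first.
  by rewrite -prodEFin; apply: eq_bigr.
(* The weight [Z] is the product of the factors other than [k], and [W] is the constant product of
   their integrals. *)
rewrite (@eq_integral_comp_mul _ _ _ P _ (mY k) _
  (cst (\prod_(i | i != k) e i)))//.
- rewrite ge0_integralZr_real//; last exact: prodr_ge0.
  exact: measurableT_comp.
- under eq_fun do rewrite -big_filter.
  by apply: measurable_prod => i _; exact: measurableT_comp.
- by move=> w; exact: prodr_ge0.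
- by move=> w; exact: prodr_ge0.
- move=> B mB.
  (* With factor [k] replaced by [\1_B], only indices in the shorter list [s] may carry a
     non-indicator, so the induction hypothesis applies to [h]. *)
  pose h i := if i == k then \1_B else g i.
  have hk i : i != k -> h i = g i by rewrite /h => /negPf ->.
  have hkk : h k = \1_B by rewrite /h eqxx.
  clearbody h.
  have mBk : measurable (Y k @^-1` B).
    by rewrite -[X in measurable X]setTI; exact: mY.
  have intB : (\int[P]_w (\1_B (Y k w))%:E = P (Y k @^-1` B))%E.
    under eq_integral do rewrite -[\1_B (Y k _)]/(\1_(Y k @^-1` B) _).
    by rewrite integral_indic// setIT.
  transitivity (\int[P]_w (\prod_i h i (Y i w))%:E)%E.
    apply: eq_integral => w _; rewrite [in RHS](bigD1 k)//= hkk.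
    by congr (_ * _)%:E; apply: eq_bigr => i ik; rewrite hk.
  rewrite IH; last 4 first.
  + by move=> i; have [->|/hk ->//] := eqVneq i k; rewrite hkk.
  + by move=> i y; have [->|/hk ->//] := eqVneq i k; rewrite hkk.
  + move=> i; have [->|ik] := eqVneq i k; last by rewrite hk.
    by rewrite hkk intB fin_num_measure.
  + move=> i iNs; have [->|ik] := eqVneq i k; first by rewrite hkk; exists B.
    by rewrite hk//; apply: gind; rewrite inE negb_or ik.
  rewrite (bigD1 k)//= hkk intB.
  rewrite [X in (_ * X)%E](_ : _ = (\prod_(i | i != k) e i)%:E)%E; last first.
    by rewrite -prodEFin; apply: eq_bigr => i ik; rewrite hk.
  rewrite ge0_integralZr_real ?intB//; last exact: prodr_ge0.
  exact: measurableT_comp.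
Qed.

End IndependentProducts.

(** * Chernoff bound for a centered linear combination *)

Lemma expeR_half_sqr (R : realType) (r : R) :
  expeR (- (r%:E ^+ 2 / 2%:E))%E = (expR (- (r ^+ 2 / 2)))%:E.
Proof. by rewrite -EFin_expe inver pnatr_eq0. Qed.

Lemma expeR_half_sqry (R : realType) :
  expeR (- ((+oo : \bar R) ^+ 2 / 2%:E))%E = 0%E.
Proof.
by rewrite expe2 mulyy inver pnatr_eq0 gt0_mulye// lte_fin invr_gt0.
Qed.

Section LinearTail.
Context d (T : measurableType d) (R : realType) (P : probability T R).
Context (I : finType) (Y : I -> T -> R) (a b : I -> R).
Hypothesis mY : forall i, measurable_fun setT (Y i).
Hypothesis indepY : mutually_independent P Y.
Hypothesis aYb : forall i, {ae P, forall w, a i <= Y i w <= b i}.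
Variable nu : I -> R.

Let m i := fine 'E_P[Y i].
Let S := \sum_i (b i - a i) ^+ 2 * nu i ^+ 2.
Let D w := \sum_i nu i * (m i - Y i w).

Lemma measurable_centered_sum : measurable_fun setT D.
Proof.
apply: measurable_sum => i; apply: measurable_funM => //.
exact: measurable_funB.
Qed.

Lemma centered_sum_mgf_le (l : R) :
  (\int[P]_w (expR (D w * l))%:E <= (expR (l ^+ 2 * S / 8))%:E)%E.
Proof.
(* [D] is centered as mean minus variable, so Hoeffding's lemma is used at the parameter
   [- (l * nu i)]. *)
pose f i y := expR (- (l * nu i) * (y - m i)).
have mf i : measurable_fun setT (f i).
  apply: measurableT_comp => //; apply: measurable_funM => //.
  exact: measurable_funB.
have f_le i : (\int[P]_w (f i (Y i w))%:E <=
    (expR ((l * nu i) ^+ 2 * (b i - a i) ^+ 2 / 8))%:E)%E.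
  by rewrite -(sqrrN (l * nu i)); exact: hoeffding_lemma.
have f_ge0 i : (0 <= \int[P]_w (f i (Y i w))%:E)%E.
  by apply: integral_ge0 => w _; rewrite lee_fin expR_ge0.
have f_fin i : (\int[P]_w (f i (Y i w))%:E \is a fin_num)%E.
  by rewrite ge0_fin_numE// (le_lt_trans (f_le i))// ltry.
have -> : (\int[P]_w (expR (D w * l))%:E =
    \int[P]_w (\prod_i f i (Y i w))%:E)%E.
  apply: eq_integral => w _; rewrite -expR_sum mulr_suml.
  by congr (expR _)%:E; apply: eq_bigr => i _; ring.
rewrite (integral_prod_independent mY indepY)//; last first.
  by move=> i y; exact: expR_ge0.
under eq_bigr => i _ do rewrite -(fineK (f_fin i)).
rewrite prodEFin lee_fin /S mulr_sumr mulr_suml expR_sum.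
apply: ler_prod => i _; rewrite fine_ge0//= -lee_fin fineK//.
apply: (le_trans (f_le i)); rewrite lee_fin ler_expR exprMn.
by rewrite le_eqVlt; apply/orP; left; apply/eqP; ring.
Qed.

Lemma centered_sum_chernoff (l t : R) : 0 < l ->
  (P [set w | (t <= D w)%R] <= (expR (l ^+ 2 * S / 8 - l * t))%:E)%E.
Proof.
move=> l0.
pose DX : {RV P >-> R} :=
  HB.pack_for {mfun T >-> R} D
    (@isMeasurableFun.Build _ _ _ _ D measurable_centered_sum).
apply: (le_trans (chernoff DX t l0)).
rewrite expRD EFinM lee_wpmul2r ?lee_fin ?expR_ge0//.
by rewrite /mmt_gen_fun unlock; exact: centered_sum_mgf_le.
Qed.

Lemma centered_sum_tail (t : R) : 0 < t ->
  (P [set w | (t <= D w)%R] <=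
   expeR (- ((t%:E / (2^-1 * Num.sqrt S)%:E) ^+ 2 / 2%:E)))%E.
Proof.
move=> t0.
have S0 : 0 <= S by apply: sumr_ge0 => i _; rewrite mulr_ge0 ?sqr_ge0.
have [SE|S_neq0] := eqVneq S 0.
  (* Here the quotient [t / 0] is [+oo], so the claimed bound is 0. *)
  rewrite SE sqrtr0 mulr0 inver eqxx gt0_muley ?lte_fin//.
  rewrite expeR_half_sqry; set E := [set w | _].
  (* Here [P E <= expR (- (l * t))] for every [l > 0], so [P E] vanishes. *)
  have Pfin : P E \is a fin_num.
    apply: fin_num_measure; rewrite -[E]setTI.
    by apply: measurable_fun_le => //; exact: measurable_centered_sum.
  rewrite leNgt; apply/negP => P_gt0.
  have p_gt0 : 0 < fine (P E) by rewrite fine_gt0// P_gt0 ltey_eq Pfin.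
  (* Chosen so that [l * t] exceeds [- ln (fine (P E))], which makes the Chernoff bound smaller than
     [P E]. *)
  pose l := (1 + `|ln (fine (P E))|) / t.
  have l0 : 0 < l by rewrite divr_gt0// ltr_pwDl.
  have := centered_sum_chernoff t l0; rewrite -/E -(fineK Pfin) lee_fin.
  rewrite SE mulr0 mul0r sub0r divfK ?gt_eqF// leNgt => /negP; apply.
  rewrite -ltr_ln ?posrE ?expR_gt0// expRK.
  by have := ler_norm (- ln (fine (P E))); rewrite normrN; lra.
have S_gt0 : 0 < S by rewrite lt_neqAle eq_sym S_neq0.
have sS : 0 < Num.sqrt S by rewrite sqrtr_gt0.
(* [4 * t / S] minimizes [l ^+ 2 * S / 8 - l * t]; the minimum is [- 2 * t ^+ 2 / S]. *)
have l0 : 0 < 4 * t / S by rewrite divr_gt0// mulr_gt0.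
apply: (le_trans (centered_sum_chernoff t l0)).
rewrite inver mulf_eq0 invr_eq0 pnatr_eq0/= (gt_eqF sS) -EFinM.
rewrite expeR_half_sqr lee_fin ler_expR.
have -> : (t / (2^-1 * Num.sqrt S)) ^+ 2 = 4 * t ^+ 2 / S.
  by rewrite expr_div_n exprMn sqr_sqrtr//; field.
rewrite le_eqVlt; apply/orP; left; apply/eqP.
by field.
Qed.

End LinearTail.

(** * Passage to the supremum *)

(** For [p > 0] the bound can be inverted: it says that [r] is at most [M = sqrt (- 2 * ln p)]. An
    upper bound on all elements of [A] is inherited by the supremum, and the inversion is then
    undone. *)
Lemma le_expeR_sup (R : realType) (p : R) (A : set (\bar R)) :
  A !=set0 -> (forall r, A r -> 0 <= r)%E ->
  (forall r, A r -> p%:E <= expeR (- (r ^+ 2 / 2%:E)))%E ->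
  (p%:E <= expeR (- (ereal_sup A ^+ 2 / 2%:E)))%E.
Proof.
move=> [r0 Ar0] A0 pA.
have [p0|p0] := leP p 0.
  by apply: (@le_trans _ _ 0%E); rewrite ?lee_fin// expeR_ge0.
pose M := Num.sqrt (- 2 * ln p).
have AM r : A r -> (r <= M%:E)%E.
  move=> Ar; have := pA _ Ar; have := A0 _ Ar.
  case: r Ar => [r|//|//] _; last first.
    by rewrite expeR_half_sqry lee_fin [p <= 0]leNgt p0.
  rewrite expeR_half_sqr !lee_fin => r_ge0 pr.
  rewrite -(ger0_norm r_ge0) -sqrtr_sqr ler_wsqrtr//.
  move: pr; rewrite -ler_ln ?posrE ?expR_gt0// expRK; lra.
(* Needed for [- 2 * ln p] to be nonnegative, hence equal to [M ^+ 2]. *)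
have p1 : p <= 1.
  have := pA _ Ar0; have := A0 _ Ar0; case: (r0) => [r|//|//] _.
    rewrite expeR_half_sqr lee_fin => /le_trans; apply.
    by rewrite -[leRHS]expR0 ler_expR oppr_le0 divr_ge0// sqr_ge0.
  by rewrite expeR_half_sqry lee_fin => /le_trans; apply.
have supM : (ereal_sup A <= M%:E)%E by apply: ge_ereal_sup => r /AM.
have sup0 : (0 <= ereal_sup A)%E.
  by apply: (le_trans (A0 _ Ar0)); exact: ereal_sup_ubound.
move: supM sup0; case: (ereal_sup A) => [q|//|//].
rewrite !lee_fin expeR_half_sqr lee_fin => qM q0.
rewrite -[leLHS]lnK ?posrE// ler_expR.
have M2 : M ^+ 2 = - 2 * ln p.
  rewrite sqr_sqrtr//.
  by rewrite mulNr oppr_ge0 pmulr_rle0// ln_le0.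
have : q ^+ 2 <= M ^+ 2 by rewrite ler_sqr ?nnegrE ?sqrtr_ge0.
by rewrite M2; lra.
Qed.

(** * Coordinates of the random vector and the intervals containing them *)

(** Coordinates are continuous, so preimages of the open intervals generating the Borel sets of the
    line are open. *)
Lemma measurable_component (R : realType) (N : nat) d (T : measurableType d)
  (P : probability T R) (X : {RV P >-> borel_rV R N}) (n : 'I_N) :
  measurable_fun setT (component X n).
Proof.
have mcoord : measurable_fun setT
    (fun x : borel_rV R N => (x : 'rV[R]_N) ord0 n).
  apply: (measurability _ (RGenOpens.measurableE R)) => _ [_ [a [b ->] <-]].
  rewrite setTI; apply: sub_sigma_algebra.
  have /continuousP := @coord_continuous R 1 N ord0 n; apply.
  exact: interval_open.
exact: (measurableT_comp mcoord (measurable_funP X)).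
Qed.

(** A real length excludes infinite endpoints. The point [x] excludes reversed endpoints, for which
    the measure would be 0 and not the difference of the endpoints. *)
Lemma itv_length_bounds (R : realType) (J : interval R) (l x : R) : x \in J ->
  lebesgue_measure [set` J] = l%:E ->
  exists2 ab : R * R, ab.2 - ab.1 = l & forall y, y \in J -> ab.1 <= y <= ab.2.
Proof.
rewrite lebesgue_measure_itv.
case: J => [[sa a|[|]] [sb b|[|]]] xJ //=; move: (xJ); rewrite in_itv//=.
- move=> /andP[/lteifW ax /lteifW xb] abl; exists (a, b) => /=.
    move: abl; rewrite lte_fin; case: ltP => [_ [] //|ba [<-]].
    by apply/eqP; rewrite subr_eq0 eq_le ba (le_trans ax xb).
  by move=> y; rewrite in_itv => /andP[/lteifW -> /lteifW ->].
- by rewrite andbF.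
- by rewrite ltry.
- by rewrite ltNyr.
Qed.

(** * Tail bound in terms of the normal distance *)

Section NormalTail.
Context (R : realType) (N : nat) d (T : measurableType d).
Context (P : probability T R) (X : {RV P >-> borel_rV R N}).
Hypothesis X_indep : mutually_independent P (component X).

Lemma normal_tail_le (a b : 'I_N -> R) (A : set (borel_rV R N)) :
  (forall n, {ae P, forall w, a n <= component X n w <= b n}) ->
  measurable A ->
  (P (X @^-1` A) <=
   expeR (- (normal_distance (side_length_Psi (fun n => b n - a n)%R)
               (expectation_rV P X) A ^+ 2 / 2%:E)))%E.
Proof.
move=> aXb mA.
have mXA : measurable (X @^-1` A).
  by rewrite -[X in measurable X]setTI; exact: (measurable_funP X).
have Pfin : P (X @^-1` A) \is a fin_num by exact: fin_num_measure.
rewrite -(fineK Pfin); apply: le_expeR_sup.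
(* For [nu = 0] the half-space is the whole space, so the supremum is over a nonempty set. *)
- eexists; exists (const_mx 0), (const_mx 0); split; last by reflexivity.
  move=> x _; rewrite /halfspace /= /dotrV.
  by rewrite !big1// => n _; rewrite mxE mul0r.
- move=> _ [p [nu [_ ->]]]; apply: mule_ge0.
    by rewrite lee_fin le_max lexx orbT.
  by rewrite inve_ge0 lee_fin mulr_ge0// sqrtr_ge0.
- move=> _ [p [nu [Anu ->]]]; rewrite (fineK Pfin).
  set t := dotrV _ _.
  (* If [t <= 0] the quotient is 0, even when [Psi nu] vanishes, and the bound is 1. *)
  have [t0|t0] := leP t 0.
    rewrite mul0e expe2 mule0 mul0e oppe0 expeR0.
    exact: probability_le1.
  apply: (le_trans _ (centered_sum_tail (measurable_component X) X_indep aXb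
    (fun n => nu ord0 n) t0)).
  apply: le_measure; rewrite ?inE//.
    rewrite -[X in measurable X]setTI.
    apply: measurable_fun_le => //.
    apply: measurable_centered_sum; exact: measurable_component.
  (* The centered sum minus [t] is [nu . p - nu . X w], nonnegative on the half-space. *)
  move=> w /= /Anu XH; rewrite -subr_ge0.
  rewrite (_ : _ - t = dotrV nu p - dotrV nu (X w)) ?subr_ge0//.
  rewrite /t /dotrV -!sumrB; apply: eq_bigr => n _.
  rewrite /component !mxE; ring.
Qed.

End NormalTail.

(** * The general bound and its two cube cases *)

(** Halving the denominator doubles every quotient, including the values 0 and [+oo] taken over a
    zero denominator. It serves the unit cube, where [Psi] is half the Euclidean norm. *)
Lemma normal_distance_half (R : realType) (N : nat) (Psi : 'rV[R]_N -> R)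
  (x : 'rV[R]_N) (A : set 'rV[R]_N) :
  normal_distance (fun nu => (2^-1 * Psi nu)%:E) x A =
  (2%:E * normal_distance (fun nu => (Psi nu)%:E) x A)%E.
Proof.
rewrite /normal_distance -ereal_sup_pZl//; congr ereal_sup.
have E (t c : R) : 0 <= t -> (t%:E / (2^-1 * c)%:E = 2%:E * (t%:E / c%:E))%E.
  rewrite le_eqVlt => /predU1P[<-|t0]; first by rewrite !mul0e mule0.
  have [->|c0] := eqVneq c 0.
    rewrite mulr0 inver eqxx gt0_muley ?lte_fin// gt0_muley//.
  rewrite !inver mulf_eq0 invr_eq0 pnatr_eq0/= (negPf c0) -!EFinM.
  by congr EFin; field.
apply/seteqP; split => [_ [p [nu [Ap ->]]]|_ [_ [p [nu [Ap ->]]]] <-].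
- exists ((Num.max (dotrV nu (x - p)) 0)%:E / (Psi nu)%:E)%E.
    by exists p, nu.
  by rewrite E// le_max lexx orbT.
- by exists p, nu; split => //; rewrite E// le_max lexx orbT.
Qed.

Theorem proposition4p2 (R : realType) (N : nat) (d : measure_display)
    (T : measurableType d) (P : probability T R)
    (X : {RV P >-> borel_rV R N})
    (X_indep : mutually_independent P (component X)) :
  (forall (I : 'I_N -> interval R) (L : 'I_N -> R),
     (forall n, lebesgue_measure [set` I n] = (L n)%:E) ->
     (forall n, {ae P, forall w, component X n w \in I n}) ->
     forall A : set (borel_rV R N), measurable A ->
       (P (X @^-1` A) <=
        expeR (- (normal_distance (side_length_Psi L) (expectation_rV P X) A ^+ 2
                  / 2%:E)))%E) /\
  (forall v : 'rV[R]_N,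
     {ae P, forall w, translate v unit_cube (X w)} ->
     forall A : set (borel_rV R N), measurable A ->
       (P (X @^-1` A) <=
        expeR (- (2%:E * euclidean_normal_distance (expectation_rV P X) A ^+ 2)))%E) /\
  (forall v : 'rV[R]_N,
     {ae P, forall w, translate v hamming_cube (X w)} ->
     forall A : set (borel_rV R N), measurable A ->
       (P (X @^-1` A) <=
        expeR (- (euclidean_normal_distance (expectation_rV P X) A ^+ 2
                  / 2%:E)))%E).
Proof.
split; [|split].
- move=> I L IL XI A mA.
  have /choice[ab abP] : forall n, exists ab : R * R, ab.2 - ab.1 = L n /\
      forall y, y \in I n -> ab.1 <= y <= ab.2.
    (* An almost sure event has an outcome, so [I n] contains a point and has endpoints exactly
       [L n] apart. *)
    move=> n; have [w Xw] := ae_nonempty (XI n).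
    by have [ab] := itv_length_bounds Xw (IL n); exists ab.
  have -> : L = fun n => (ab n).2 - (ab n).1.
    by apply/funext => n; have [<-] := abP n.
  apply: normal_tail_le => // n; apply: filterS (XI n) => w.
  by have [_] := abP n; apply.
- move=> v Xv A mA.
  (* All sides have length 1; the factor 2 from halving the norm turns [d ^+ 2 / 2] into
     [2 * d ^+ 2]. *)
  have := @normal_tail_le _ _ _ _ _ X X_indep (v ord0)
    (fun n => v ord0 n + 1) A _ mA.
  have -> : @side_length_Psi R N (fun n => v ord0 n + 1 - v ord0 n) =
      fun nu => (2^-1 * euclidean_norm nu)%:E.
    apply/funext => nu; rewrite /side_length_Psi /euclidean_norm.
    do 3 congr (_ _); apply: eq_bigr => n _.
    by rewrite addrAC subrr add0r expr1n mul1r.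
  rewrite normal_distance_half -/(euclidean_normal_distance _ _).
  have -> (q : \bar R) : ((2%:E * q) ^+ 2 / 2%:E = 2%:E * q ^+ 2)%E.
    rewrite !expe2 inver pnatr_eq0/=; case: q => [q||].
    - by rewrite -!EFinM; congr EFin; field.
    - by rewrite gt0_muley// mulyy gt0_mulye ?gt0_muley// lte_fin invr_gt0.
    - by rewrite gt0_muleNy// mulNyNy gt0_mulye ?gt0_muley// lte_fin invr_gt0.
  apply => n; apply: filterS Xv => w [x /(_ n) x01 vx].
  by rewrite /component -vx mxE lerDl lerD2l.
- move=> v Xv A mA.
  (* All sides have length 2, which cancels the factor [2^-1] and makes [Psi] the Euclidean norm
     itself. *)
  have := @normal_tail_le _ _ _ _ _ X X_indep (fun n => v ord0 n - 1)
    (fun n => v ord0 n + 1) A _ mA.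
  have -> : @side_length_Psi R N (fun n => v ord0 n + 1 - (v ord0 n - 1)) =
      fun nu => (euclidean_norm nu)%:E.
    apply/funext => nu; rewrite /side_length_Psi /euclidean_norm.
    congr EFin; under eq_bigr => n _.
      rewrite (_ : v ord0 n + 1 - _ = 2); last by ring.
      over.
    rewrite -mulr_sumr sqrtrM ?sqr_ge0// sqrtr_sqr normr_nat.
    by rewrite mulrA mulVf ?mul1r.
  apply => n; apply: filterS Xv => w [x /(_ n) x01 vx].
  by rewrite /component -vx mxE; case: x01 => ->; apply/andP; split; lra.
Qed.
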